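(* Let $\tau$ be a structure with a space-rooted metrization $\tau^{\mathrm{srm}}$. Let $\mathcal{X}_n=(X_n,\rho_{X_n},a_{X_n})$, $n\in\mathbb{N}\cup\{\infty\}$, be elements of $\mathfrak{M}_\bullet(\tau)$. The following are equivalent: (i) $\mathcal{X}_n\to\mathcal{X}_\infty$ with respect to $d_{\mathfrak{M}_\bullet}^{\tau^{\mathrm{srm}}}$, i.e. $d_{\mathfrak{M}_\bullet}^{\tau^{\mathrm{srm}}}(\mathcal{X}_n,\mathcal{X}_\infty)\to 0$; (ii) there exist a rooted bcm space $(M,\rho_M)$ and root-preserving isometric embeddings $f_n\colon X_n\to M$, $n\in\mathbb{N}\cup\{\infty\}$, such that $f_n(X_n)\to f_\infty(X_\infty)$ in the Fell topology as closed subsets of $M$, and $\tau_{f_n}(a_{X_n})\to\tau_{f_\infty}(a_{X_\infty})$ in $\tau(M)$.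
   Context: A bcm (boundedly-compact metric) space is a non-empty metric space in which every closed ball of finite radius is compact; a rooted bcm space $(X,\rho_X)$ is a bcm space $X$ with a distinguished point $\rho_X$. The metric of $X$ is denoted $d_X$, and $D_X(x,r)=\{y: d_X(x,y)\le r\}$. An isometric embedding is a distance-preserving map (not necessarily onto); an isometry is a bijective one; a map is root-preserving if it sends root to root. A topological embedding is a homeomorphism onto its image. Structure: a functor $\tau$ from the category of bcm spaces (morphisms: isometric embeddings) to the category of metrizable topological spaces (morphisms: topological embeddings). That is, to each bcm space $X$ it assigns a metrizable space $\tau(X)$ and to each isometric embedding $f\colon X\to Y$ a topological embedding $\tau_f\colon\tau(X)\to\tau(Y)$, with $\tau_{\mathrm{id}_X}=\mathrm{id}_{\tau(X)}$ and $\tau_{g\circ f}=\tau_g\circ\tau_f$. $\mathfrak{M}_\bullet(\tau)$: the set of (representatives of) equivalence classes of triples $(X,\rho_X,a_X)$, with $(X,\rho_X)$ a rooted bcm space and $a_X\in\tau(X)$, where $(X,\rho_X,a_X)\sim(Y,\rho_Y,a_Y)$ iff there is a root-preserving isometry $f\colon X\to Y$ with $\tau_f(a_X)=a_Y$. Space-rooted metrization $\tau^{\mathrm{srm}}$ of $\tau$: a choice, for each rooted bcm space $(X,\rho_X)$, of a metric $d^{\tau^{\mathrm{srm}}}_{X,\rho_X}$ on $\tau(X)$ inducing the given topology of $\tau(X)$, such that for every root-preserving isometric embedding $f\colon(X,\rho_X)\to(Y,\rho_Y)$ the map $\tau_f$ is distance-preserving. Hausdorff metric on compact subsets (including $\emptyset$)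 of a metric space $M$: $d^H_M(A,B)=\inf\{\varepsilon\ge0: A\subseteq B^\varepsilon, B\subseteq A^\varepsilon\}$, where $A^\varepsilon=\{x:\exists y\in A, d_M(x,y)\le\varepsilon\}$ and $\inf\emptyset=\infty$. For a rooted bcm space $(M,\rho)$ and closed $A,B\subseteq M$, $$d^F_{M,\rho}(A,B)=\int_0^\infty e^{-r}\bigl(1\wedge d^H_M(A\cap D_M(\rho,r),B\cap D_M(\rho,r))\bigr)dr.$$ The Fell topology on the set of closed subsets of $M$ is generated by the sets $\{A: A\cap K=\emptyset\}$ ($K$ compact) and $\{A: A\cap U\ne\emptyset\}$ ($U$ open); it is induced by $d^F_{M,\rho}$. For $\mathcal{X}=(X,\rho_X,a_X)$, $\mathcal{Y}=(Y,\rho_Y,a_Y)$ in $\mathfrak{M}_\bullet(\tau)$, $$d_{\mathfrak{M}_\bullet}^{\tau^{\mathrm{srm}}}(\mathcal{X},\mathcal{Y})=\inf_{f,g,Z}\bigl\{d^F_{Z,\rho_Z}(f(X),g(Y))\vee d^{\tau^{\mathrm{srm}}}_{Z,\rho_Z}(\tau_f(a_X),\tau_g(a_Y))\bigr\},$$ the infimum being over all rooted bcm spaces $(Z,\rho_Z)$ and root-preserving isometric embeddings $f\colon X\to Z$, $g\colon Y\to Z$. *)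

(* Defs.v *)
From HB Require Import structures.
From mathcomp Require Import all_boot all_order all_algebra.
From mathcomp Require Import all_classical all_reals all_analysis.

Set Implicit Arguments.
Unset Strict Implicit.
Unset Printing Implicit Defensive.

Import Order.TTheory GRing.Theory Num.Theory.
Import numFieldNormedType.Exports.

Local Open Scope classical_set_scope.
Local Open Scope ring_scope.

Definition dball (R : realType) (T : metricType R) (x : T) (r : R) : set T :=
  [set y | mdist x y <= r].

Record bcmSpace (R : realType) := BcmSpace {
  bcm_car :> metricType R;
  bcm_nonempty : [set: bcm_car] !=set0;
  bcm_compact : forall (x : bcm_car) (r : R), compact (dball x r) }.

Record rootedBcm (R : realType) := RootedBcm {
  rooted_space :> bcmSpace R;
  broot : rooted_space }.
Arguments broot {R} _.

Record isoemb (R : realType) (X Y : bcmSpace R) := IsoEmb {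
  isoemb_fun :> X -> Y;
  isoembP : forall x y : X, mdist (isoemb_fun x) (isoemb_fun y) = mdist x y }.

Record rooted_isoemb (R : realType) (X Y : rootedBcm R) := RootedIsoEmb {
  rooted_isoemb_isoemb :> isoemb X Y;
  isoemb_root : rooted_isoemb_isoemb (broot X) = broot Y }.

Definition isoemb_id (R : realType) (X : bcmSpace R) : isoemb X X :=
  @IsoEmb R X X idfun (fun _ _ => erefl).

Lemma isoemb_comp_subproof (R : realType) (X Y Z : bcmSpace R)
    (g : isoemb Y Z) (f : isoemb X Y) (x y : X) :
  mdist ((g \o f) x) ((g \o f) y) = mdist x y.
Proof. by rewrite /= !isoembP. Qed.

Definition isoemb_comp (R : realType) (X Y Z : bcmSpace R)
    (g : isoemb Y Z) (f : isoemb X Y) : isoemb X Z :=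
  IsoEmb (isoemb_comp_subproof g f).

(* [d] is a metric on the set [T] whose metric topology is that of [T];
   nonnegativity follows from the other axioms. *)
Record metrizes (R : realType) (T : topologicalType) (d : T -> T -> R) : Prop :=
  Metrizes {
    metrizes_xx : forall x, d x x = 0;
    metrizes_eq : forall x y, d x y = 0 -> x = y;
    metrizes_sym : forall x y, d x y = d y x;
    metrizes_triangle : forall x y z, d x z <= d x y + d y z;
    metrizes_nbhs : forall x, nbhs x =
      filter_from [set e : R | 0 < e] (fun e => [set y | d x y < e]) }.

Definition metrizable (R : realType) (T : topologicalType) : Prop :=
  exists d : T -> T -> R, metrizes d.

(* The last clause says that [f] is open onto its image, for the subspace
   topology. *)
Definition topological_embedding (S T : topologicalType) (f : S -> T) : Prop :=
  [/\ injective f, continuous f &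
      forall U : set S, open U ->
        exists2 V : set T, open V & f @` U = V `&` range f].

Record structure (R : realType) := Structure {
  tau_obj :> bcmSpace R -> topologicalType;
  tau_metrizable : forall X, metrizable R (tau_obj X);
  tau_map : forall X Y : bcmSpace R, isoemb X Y -> tau_obj X -> tau_obj Y;
  tau_embedding : forall (X Y : bcmSpace R) (f : isoemb X Y),
    topological_embedding (tau_map f);
  tau_id : forall (X : bcmSpace R) (a : tau_obj X), tau_map (isoemb_id X) a = a;
  tau_comp : forall (X Y Z : bcmSpace R) (g : isoemb Y Z) (f : isoemb X Y)
    (a : tau_obj X), tau_map (isoemb_comp g f) a = tau_map g (tau_map f a) }.
Arguments tau_map {R} _ {X Y} _ _.

Record space_rooted_metrization (R : realType) (tau : structure R) :=
  SpaceRootedMetrization {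
    srm_metric : forall X : rootedBcm R, tau X -> tau X -> R;
    srm_metrizes : forall X : rootedBcm R, metrizes (@srm_metric X);
    srm_isometric : forall (X Y : rootedBcm R) (f : rooted_isoemb X Y)
      (a b : tau X),
      srm_metric (tau_map tau f a) (tau_map tau f b) = srm_metric a b }.
Arguments srm_metric {R tau} _ _ _ _.

(* Triples (X, rho_X, a_X): the representatives of the elements of the moduli
   space of [tau], two triples being identified when [marked_equiv] relates
   them; [srm_dist] below is compatible with this ([srm_dist_equivl] and
   [srm_dist_equivr]). *)
Record marked (R : realType) (tau : structure R) := Marked {
  marked_space :> rootedBcm R;
  mark : tau marked_space }.
Arguments mark {R tau} _.

Definition marked_equiv (R : realType) (tau : structure R) (X Y : marked tau)
    : Prop :=
  exists f : rooted_isoemb X Y,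
    set_surj [set: X] [set: Y] f /\ tau_map tau f (mark X) = mark Y.

Definition thickening (R : realType) (M : metricType R) (A : set M) (e : R)
    : set M :=
  [set x | exists2 y, A y & mdist x y <= e].

(* The value is [+oo] when exactly one of [A] and [B] is empty. *)
Definition hausdorff_dist (R : realType) (M : metricType R) (A B : set M)
    : \bar R :=
  ereal_inf (EFin @` [set e : R |
    [/\ 0 <= e, A `<=` thickening B e & B `<=` thickening A e]]).

Definition fell_dist (R : realType) (M : rootedBcm R) (A B : set M) : \bar R :=
  (\int[lebesgue_measure]_(r in `[0%R, +oo[)
    ((expR (- r))%:E *
     mine 1 (hausdorff_dist (A `&` dball (broot M) r)
                            (B `&` dball (broot M) r))))%E.

Definition srm_dist (R : realType) (tau : structure R)
    (srm : space_rooted_metrization tau) (X Y : marked tau) : \bar R :=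
  ereal_inf [set t : \bar R |
    exists (Z : rootedBcm R) (f : rooted_isoemb X Z) (g : rooted_isoemb Y Z),
      t = maxe (fell_dist (range f : set Z) (range g : set Z))
               (srm_metric srm Z (tau_map tau f (mark X))
                                 (tau_map tau g (mark Y)))%:E].

Record closedSet (M : topologicalType) := ClosedSet {
  closed_car :> set M;
  closed_carP : closed closed_car }.

HB.instance Definition _ (M : topologicalType) := gen_eqMixin (closedSet M).
HB.instance Definition _ (M : topologicalType) := gen_choiceMixin (closedSet M).

Definition fell_subbase (M : topologicalType) : set (set (closedSet M)) :=
  [set W | exists2 K : set M, compact K &
             W = [set A : closedSet M | A `&` K = set0]] `|`
  [set W | exists2 U : set M, open U &
             W = [set A : closedSet M | A `&` U !=set0]].

(* The Fell topology is the canonical topology on [closedSet M]. *)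
HB.instance Definition _ (M : topologicalType) :=
  @isSubBaseTopological.Build (closedSet M)
    (set (closedSet M)) (@fell_subbase M) id.

Lemma isoemb_range_closed (R : realType) (X Y : bcmSpace R) (f : isoemb X Y) :
  closed (range f).
Proof.
have fc : continuous f.
  move=> x; apply/metricType_numDomainType.cvgrPdist_lt => e e0.
  rewrite near_simpl.
  have /= := @metricType_numDomainType.cvgrPdist_lt R X X (nbhs x) _ id x.
  move=> [/(_ (fun A h => h))/(_ _ e0) + _]; apply: filterS => t.
  by rewrite isoembP.
move=> y yf.
have [_ [[x _ <-]]] := yf _ (nbhsx_ballx y 1 ltr01).
rewrite ballEmdist/= => yfx.
have Kc : closed (f @` dball x 2).
  apply: compact_closed; first exact: metric_hausdorff.
  apply: continuous_compact; last exact: bcm_compact.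
  exact: continuous_subspaceT.
suff [z _ <-] : (f @` dball x 2) y by exists z.
apply: Kc => B By.
have [_ [[z _ <-] [Bz]]] :=
  yf _ (filterI By (nbhsx_ballx y 1 ltr01)).
rewrite ballEmdist/= => yfz.
exists (f z); split=> //; exists z => //; rewrite /dball/= -(isoembP f).
apply: le_trans (metric_triangle _ y _) _.
by apply: (@lerD _ _ 1 _ 1); apply: ltW => //; rewrite metric_sym.
Qed.

Definition isoemb_image (R : realType) (X Y : bcmSpace R) (f : isoemb X Y)
    : closedSet Y :=
  ClosedSet (@isoemb_range_closed R X Y f).

Section srm_dist_equiv.
Variables (R : realType) (tau : structure R).
Variable srm : space_rooted_metrization tau.

Lemma rooted_comp_subproof (X Y Z : rootedBcm R) (g : rooted_isoemb Y Z)
  (f : rooted_isoemb X Y) : isoemb_comp g f (broot X) = broot Z.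
Proof. by rewrite /= !isoemb_root. Qed.

Definition rooted_comp (X Y Z : rootedBcm R) (g : rooted_isoemb Y Z)
    (f : rooted_isoemb X Y) : rooted_isoemb X Z :=
  RootedIsoEmb (rooted_comp_subproof g f).

Lemma isoemb_inj (X Y : bcmSpace R) (f : isoemb X Y) : injective f.
Proof. by move=> x y fxy; apply: mdist_positivity; rewrite -(isoembP f) fxy mdistxx. Qed.

Lemma isoemb_ext (X Y : bcmSpace R) (f g : isoemb X Y) : f =1 g -> f = g.
Proof.
case: f g => [f fP] [g gP] /= /funext fg; subst g.
by rewrite (Prop_irrelevance fP gP).
Qed.

Lemma marked_equiv_refl (X : marked tau) : marked_equiv X X.
Proof.
by exists (@RootedIsoEmb R X X (isoemb_id X) erefl); split;
  [move=> x _; exists x|exact: tau_id].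
Qed.

Lemma marked_equiv_trans (X Y Z : marked tau) :
  marked_equiv X Y -> marked_equiv Y Z -> marked_equiv X Z.
Proof.
move=> [f [fs fa]] [g [gs ga]]; exists (rooted_comp g f); split.
  move=> z /gs[y /fs[x _ <-] <-]; by exists x.
by rewrite tau_comp fa ga.
Qed.

Lemma marked_equiv_sym (X Y : marked tau) :
  marked_equiv X Y -> marked_equiv Y X.
Proof.
move=> [f [fs fa]].
have /choice[h hK] : forall y : Y, exists x : X, f x = y.
  by move=> y; have [//|x _ <-] := fs y; exists x.
have hP (x y : Y) : mdist (h x) (h y) = mdist x y.
  by rewrite -(isoembP f) !hK.
have hr : IsoEmb hP (broot Y) = broot X.
  by apply: (@isoemb_inj _ _ f); rewrite /= hK isoemb_root.
exists (RootedIsoEmb hr); split.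
  by move=> x _; exists (f x) => //; apply: (@isoemb_inj _ _ f); rewrite /= hK.
rewrite -fa -tau_comp -[RHS]tau_id; congr tau_map.
by apply: isoemb_ext => x; apply: (@isoemb_inj _ _ f); rewrite /= hK.
Qed.

Lemma hausdorff_distC (M : metricType R) (A B : set M) :
  hausdorff_dist A B = hausdorff_dist B A.
Proof.
by congr (ereal_inf (EFin @` _)); apply/seteqP; split=> e [].
Qed.

Lemma fell_distC (M : rootedBcm R) (A B : set M) :
  fell_dist A B = fell_dist B A.
Proof. by apply: eq_integral => r _; rewrite hausdorff_distC. Qed.

Lemma srm_distC (X Y : marked tau) : srm_dist srm X Y = srm_dist srm Y X.
Proof.
congr ereal_inf; apply/seteqP; split=> t [Z [f [g ->]]]; exists Z, g, f;
  by rewrite (metrizes_sym (srm_metrizes srm Z)) fell_distC.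
Qed.

Lemma srm_dist_equivl (X X' Y : marked tau) :
  marked_equiv X X' -> srm_dist srm X Y = srm_dist srm X' Y.
Proof.
have le (U V : marked tau) : marked_equiv U V ->
    (srm_dist srm U Y <= srm_dist srm V Y)%E.
  move=> [f [fs fa]]; apply: le_ereal_inf_tmp => t [Z [g [h ->]]].
  apply: ereal_inf_lbound; exists Z, (rooted_comp g f), h.
  have gf : range (rooted_comp g f) = range g.
    apply/seteqP; split=> [_ [u _ <-]|_ [v _ <-]]; first by exists (f u).
    by have [//|u _ <-] := fs v; exists u.
  by rewrite tau_comp fa gf.
move=> XX'; apply/eqP; rewrite eq_le !le//; exact: marked_equiv_sym.
Qed.

Lemma srm_dist_equivr (X Y Y' : marked tau) :
  marked_equiv Y Y' -> srm_dist srm X Y = srm_dist srm X Y'.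
Proof. by move=> YY'; rewrite ![srm_dist srm X _]srm_distC; exact: srm_dist_equivl. Qed.

End srm_dist_equiv.

(* Main.v *)
(* (ii) => (i): Fell convergence of A_n to A in M means that, up to any radius
   and any error, A_n and A are eventually contained in thickenings of each
   other.  Cutting with a ball D(rho, r) can only spoil this for r near one of
   finitely many distances from rho to the cells of a finite cover of A, so
   the integral defining d^F is small.

   (i) => (ii): a pair of embeddings X_n -> Z_n <- Xoo enters only through the
   cross distances c_n(x, y) = d_{Z_n}(f x, g y), a "coupling" of X_n and Xoo:
   the mark distance computed in Z_n equals the one computed in the union of
   the two images, which embeds in any other space with the same coupling.
   Gluing all the X_n to Xoo along near-optimal couplings gives a pseudometric
   on their disjoint union; its metric quotient M is boundedly compact because
   the part of X_n in a given ball lies, for large n, in an arbitrarily small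
   thickening of Xoo. *)
Require Import Defs.
From HB Require Import structures.
From mathcomp Require Import all_boot all_order all_algebra.
From mathcomp Require Import finmap.
From mathcomp Require Import all_classical all_reals all_analysis.
From mathcomp Require Import measurable_realfun ring lra.

Set Implicit Arguments.
Unset Strict Implicit.
Unset Printing Implicit Defensive.

Import Order.TTheory GRing.Theory Num.Theory.
Import numFieldNormedType.Exports.

Local Open Scope classical_set_scope.
Local Open Scope ring_scope.

(** * Bounds on the Fell distance *)

(* Unlike [ge0_le_integral], no measurability is required: the integrand of
   [fell_dist] is not known to be measurable. *)
Lemma le_integral_ge0 d (T : measurableType d) (R : realType)
    (mu : {measure set T -> \bar R}) (D : set T) (f g : T -> \bar R) :
  (forall x, D x -> 0 <= f x)%E -> (forall x, D x -> f x <= g x)%E ->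
  (\int[mu]_(x in D) f x <= \int[mu]_(x in D) g x)%E.
Proof.
move=> f0 fg; rewrite !(integral_mkcond D).
have g0 x : D x -> (0 <= g x)%E by move=> Dx; exact: le_trans (f0 _ Dx) (fg _ Dx).
have fg' x : ((f \_ D) x <= (g \_ D) x)%E.
  by rewrite !patchE; case: ifPn => // /set_mem; exact: fg.
rewrite !ge0_integralTE; first last.
- exact: erestrict_ge0.
- exact: erestrict_ge0.
apply: ereal_sup_le => _ [h hf <-]; exists h => // x.
exact: le_trans (hf x) (fg' x).
Qed.

Section fell_dist_estimates.
Variable R : realType.
Local Notation mu := (@lebesgue_measure R).

Lemma integral_expRN (a : R) :
  (\int[mu]_(r in `[a, +oo[) (expR (- r))%:E = (expR (- a))%:E)%E.
Proof.
have cE : continuous (fun x : R => expR (- x)).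
  move=> x; apply: continuous_comp; first exact: opp_continuous.
  exact: continuous_expR.
rewrite (@ge0_continuous_FTC2y _ _ (fun x => - expR (- x)) _ 0).
- by rewrite EFinN oppeK add0e.
- by move=> x _; exact: expR_ge0.
- exact: continuous_subspaceT.
- by rewrite -oppr0; apply: cvgN; exact: cvgr_expR.
- by move=> x _; exact: ex_derive.
- apply: cvg_at_right_filter; apply: cvgN; first exact: cE.
- move=> x _; rewrite derive1E derive_val.  by rewrite /= mulrN1 opprK.
Qed.

Lemma hausdorff_dist_ge0 (M : metricType R) (A B : set M) :
  (0 <= hausdorff_dist A B)%E.
Proof. by apply: le_ereal_inf_tmp => _ [e [e0 _ _] <-]; rewrite lee_fin. Qed.

Lemma hausdorff_dist_le (M : metricType R) (A B : set M) (e : R) :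
  0 <= e -> A `<=` thickening B e -> B `<=` thickening A e ->
  (hausdorff_dist A B <= e%:E)%E.
Proof. by move=> e0 AB BA; apply: ereal_inf_lbound; exists e. Qed.

Lemma hausdorff_dist_lt (M : metricType R) (A B : set M) (e : R) :
  (hausdorff_dist A B < e%:E)%E ->
  A `<=` thickening B e /\ B `<=` thickening A e.
Proof.
move=> /ereal_inf_lt[_ [d [d0 AB BA] <-]]; rewrite lte_fin => /ltW de.
by split=> x; [move=> /AB|move=> /BA] => -[y Yy xy]; exists y => //;
  exact: le_trans xy de.
Qed.

Definition fell_integrand (M : rootedBcm R) (A B : set M) (r : R) : \bar R :=
  ((expR (- r))%:E *
     mine 1 (hausdorff_dist (A `&` dball (broot M) r)
                            (B `&` dball (broot M) r)))%E.

Lemma fell_integrand_ge0 (M : rootedBcm R) (A B : set M) r :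
  (0 <= fell_integrand A B r)%E.
Proof.
apply: mule_ge0; first by rewrite lee_fin expR_ge0.
by rewrite le_min lee_fin ler01 hausdorff_dist_ge0.
Qed.

Lemma fell_dist_ge0 (M : rootedBcm R) (A B : set M) : (0 <= fell_dist A B)%E.
Proof. by apply: integral_ge0 => r _; exact: fell_integrand_ge0. Qed.

(** If the cuts at every radius in [[r, r + 1]] had Hausdorff distance at least [e], the integrand
    would be at least [expR (- (r + 1)) * e] on an interval of length 1; [e <= 1] keeps this true
    after truncation at 1. A good radius [s >= r] then serves [r] as well, since the approximating
    set is not cut in the conclusion. *)
Lemma fell_dist_lt_close (M : rootedBcm R) (A B : set M) (r e : R) :
  0 <= r -> 0 < e <= 1 ->
  (fell_dist A B < (expR (- (r + 1)) * e)%:E)%E ->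
  A `&` dball (broot M) r `<=` thickening B e /\
  B `&` dball (broot M) r `<=` thickening A e.
Proof.
move=> r0 /andP[e0 e1] ABlt.
have [s [rs sAB]] : exists s, r <= s /\
    (hausdorff_dist (A `&` dball (broot M) s) (B `&` dball (broot M) s) < e%:E)%E.
  apply: contrapT => /forallNP H; move: ABlt; apply/negP; rewrite -leNgt.
  pose I : set R := `[r, r + 1]%classic.
  pose k := ((expR (- (r + 1)) * e)%:E : \bar R).
  rewrite -/k.
  have muI : mu I = 1%E.
    rewrite lebesgue_measure_itv/= lte_fin ltrDl ltr01.
    by rewrite -EFinD addrAC subrr add0r.
  have <- : (\int[mu]_(x in `[0%R, +oo[) ((cst k \_ I) x) = k)%E.
    rewrite -integral_mkcondr setIidr; last first.
      by move=> x /=; rewrite !in_itv/= andbT => /andP[/(le_trans r0)].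
    rewrite integral_cst; last exact: measurable_itv.
    exact: eq_trans (congr1 (mule k) muI) (mule1 k).
  apply: le_integral_ge0 => s; rewrite /= in_itv/= andbT => s0.
    by rewrite patchE; case: ifP => //; rewrite lee_fin mulr_ge0 ?expR_ge0 ?(ltW e0).
  rewrite patchE; case: ifP => [|_]; last exact: fell_integrand_ge0.
  rewrite inE /I/= in_itv/= => /andP[rs sr1]; rewrite /k EFinM.
  apply: lee_pmul; rewrite ?lee_fin ?expR_ge0 ?(ltW e0)//.
    by rewrite ler_expR lerN2.
  rewrite le_min lee_fin e1/= leNgt; apply/negP => lt.
  by apply: (H s).
have [AB BA] := hausdorff_dist_lt sAB.
split=> x [Xx xr]; [have [] := AB x|have [] := BA x].
- by split=> //; exact: le_trans xr rs.
- by move=> y [Yy _] xy; exists y.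
- by split=> //; exact: le_trans xr rs.
- by move=> y [Yy _] xy; exists y.
Qed.

(** The integrand is at most [c * expR (- r)] below [T] and away from [s], at most [expR (- r)]
    beyond [T], and at most 1 on the interval of length [2 * d] around each member of [s].
    Integrating these bounds yields the three summands. *)
Lemma fell_dist_le (M : rootedBcm R) (A B : set M) (c d T : R) (s : seq R) :
  0 <= c -> 0 <= d -> 0 <= T ->
  (forall r, 0 <= r <= T -> (forall m, m \in s -> d < `|r - m|) ->
    (hausdorff_dist (A `&` dball (broot M) r) (B `&` dball (broot M) r)
       <= c%:E)%E) ->
  (fell_dist A B <= (c + expR (- T) + d *+ 2 *+ size s)%:E)%E.
Proof.
move=> c0 d0 T0 H.
pose I m : set R := `[m - d, m + d]%classic.
pose J : set R := `[T, +oo[%classic.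
have mE (D : set R) : measurable_fun D (fun r : R => (expR (- r))%:E : \bar R).
  apply/measurable_EFinP; apply: measurableT_comp => //.
have m1 (D E : set R) : measurable E -> measurable_fun D (fun r : R => (\1_E r)%:E : \bar R).
  by move=> mE'; apply/measurable_EFinP; exact: measurable_indic.
pose G r : \bar R := (c%:E * (expR (- r))%:E + (expR (- r))%:E * (\1_J r)%:E +
   \sum_(m <- s) (\1_(I m) r)%:E)%E.
apply: (@le_trans _ _ (\int[mu]_(r in `[0%R, +oo[) G r)%E).
  apply: le_integral_ge0 => r; rewrite /= in_itv/= andbT => r0.
    exact: fell_integrand_ge0.
  have S0 : (0 <= \sum_(m <- s) ((\1_(I m) r)%:E : \bar R))%E.
    by apply: sume_ge0 => m _; rewrite lee_fin.
  have [Tr|rT] := leP T r.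
    apply: (@le_trans _ _ ((expR (- r))%:E * (\1_J r)%:E)%E).
      rewrite indicE mem_set /J/= ?in_itv/= ?Tr// mule1.
      rewrite -[leRHS]mule1; apply: lee_wpmul2l; first by rewrite lee_fin expR_ge0.
      by rewrite ge_min lexx.
    rewrite /G addeAC; apply: leeDr; apply: adde_ge0 => //.
    by rewrite mule_ge0// lee_fin expR_ge0.
  have [[m [ms mr]]|nm] := pselect (exists m, m \in s /\ `|r - m| <= d).
    apply: (@le_trans _ _ 1%E).
      rewrite -[leRHS]mule1; apply: lee_pmul.
      - by rewrite lee_fin expR_ge0.
      - by rewrite le_min lee_fin ler01 hausdorff_dist_ge0.
      - by rewrite lee_fin -expR0 ler_expR oppr_le0.
      - by rewrite ge_min lexx.
    apply: (@le_trans _ _ (\sum_(m <- s) ((\1_(I m) r)%:E : \bar R))%E).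
      rewrite (big_rem m)//= indicE mem_set; last first.
        by rewrite /I/= in_itv/= -ler_distl.
      by apply: leeDl; apply: sume_ge0 => k _; rewrite lee_fin.
    apply: leeDr; apply: adde_ge0; apply: mule_ge0; rewrite lee_fin ?expR_ge0//.
  apply: (@le_trans _ _ (c%:E * (expR (- r))%:E)%E).
    rewrite muleC; apply: lee_wpmul2r; first by rewrite lee_fin expR_ge0.
    rewrite ge_min; apply/orP; right; apply: H; first by rewrite r0 ltW.
    by move=> m ms; rewrite ltNge; apply/negP => ?; apply: nm; exists m.
  rewrite /G -addeA; apply: leeDl; apply: adde_ge0 => //.
rewrite /G ge0_integralD//=; first last.
- by apply: emeasurable_sum => m; apply: m1; exact: measurable_itv.
- by move=> r _; apply: sume_ge0 => m _; rewrite lee_fin.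
- apply: emeasurable_funD.
    by apply: emeasurable_funM; [exact: measurable_cst|exact: mE].
  by apply: emeasurable_funM; [exact: mE|apply: m1; exact: measurable_itv].
- by move=> r _; apply: adde_ge0; apply: mule_ge0; rewrite lee_fin ?expR_ge0.
have -> : (\int[mu]_(r in `[0%R, +oo[)
      (c%:E * (expR (- r))%:E + (expR (- r))%:E * (\1_J r)%:E) =
    \int[mu]_(r in `[0%R, +oo[) (c%:E * (expR (- r))%:E) +
    \int[mu]_(r in `[0%R, +oo[) ((expR (- r))%:E * (\1_J r)%:E))%E.
  apply: ge0_integralD => //.
  - by move=> r _; apply: mule_ge0; rewrite lee_fin ?expR_ge0.
  - by apply: emeasurable_funM; [exact: measurable_cst|exact: mE].
  - by apply: emeasurable_funM; [exact: mE|apply: m1; exact: measurable_itv].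
have -> : (\int[mu]_(r in `[0%R, +oo[) (c%:E * (expR (- r))%:E))%E = c%:E.
  transitivity (c%:E * \int[mu]_(r in `[0%R, +oo[) (expR (- r))%:E)%E.
    by apply: ge0_integralZl => //; exact: mE.
  by rewrite integral_expRN oppr0 expR0 mule1.
have -> : (\int[mu]_(r in `[0%R, +oo[) ((expR (- r))%:E * (\1_J r)%:E))%E = (expR (- T))%:E.
  transitivity (\int[mu]_(r in `[0%R, +oo[)
      (((fun r => (expR (- r))%:E : \bar R) \_ J) r))%E.
    by apply: eq_integral => r _; rewrite epatch_indic.
  rewrite -integral_mkcondr setIidr ?integral_expRN// => r.
  by rewrite /J/= !in_itv/= !andbT; exact: le_trans.
rewrite !EFinD; apply: leeD => //.
rewrite ge0_integral_sum//; last by move=> m; apply: m1; exact: measurable_itv.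
elim: s {H G} => [|m s IH]; first by rewrite big_nil.
rewrite big_cons mulrS EFinD; apply: leeD => //.
rewrite integral_indic; [|by []|exact: measurable_itv].
apply: (@le_trans _ _ (mu (I m))).
  apply: le_measure; rewrite ?inE; [apply: measurableI| |exact: subIsetl];
    exact: measurable_itv.
rewrite lebesgue_measure_itv/= lte_fin; case: ifP => _; rewrite -?EFinD lee_fin; lra.
Qed.

End fell_dist_estimates.

(** * Fell convergence *)

Section fell_topology.
Variable M : topologicalType.

Lemma nbhs_fell_subbase (A : closedSet M) (W : set (closedSet M)) :
  fell_subbase W -> W A -> nbhs A W.
Proof.
move=> sW WA; exists W; split => //=.
exists [set W]; last by rewrite bigcup_set1.
by move=> _ ->; exact: (@finI_from1 _ _ _ id W).
Qed.

(** Every neighbourhood contains a finite intersection of subbasic sets around the point, and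
    filters are stable under finite intersections. *)
Lemma fell_subbase_cvgP T (F : set_system T) (a : T -> closedSet M)
    (A : closedSet M) : Filter F ->
  (a @ F --> A) <->
  (forall W, fell_subbase W -> W A -> \forall x \near F, W (a x)).
Proof.
move=> FF; split=> [aA W sW WA|H V]; first exact: aA (nbhs_fell_subbase sW WA).
case=> _ [[D Dsub <-] [W DW WA] DV]; have [I Isub IW] := Dsub _ DW.
apply: filterS (_ : F (a @^-1` W)) => [x Wx|]; first by apply: DV; exists W.
rewrite -IW; apply: filter_bigI => V' V'I; apply: H.
  by have := Isub _ V'I; rewrite inE.
by move: WA; rewrite -IW; exact.
Qed.

End fell_topology.

(** Only the set being approximated is cut. Cutting both would make the condition sensitive to
    points near the bounding sphere; this form passes to smaller radii. *)
Definition close_upto (R : realType) (M : rootedBcm R) (r e : R) (A B : set M) :=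
  A `&` dball (broot M) r `<=` thickening B e /\
  B `&` dball (broot M) r `<=` thickening A e.

Section fell_metric.
Variables (R : realType) (M : rootedBcm R).
Local Notation rho := (broot M).

Let nbhs_dist (x : M) (e : R) : 0 < e -> \forall y \near x, mdist x y < e.
Proof.
by move=> e0; have := nbhsx_ballx x e e0; rewrite ballEmdist.
Qed.

Lemma compact_dball_bounded (K : set M) : compact K ->
  exists r, K `<=` dball rho r.
Proof.
move=> /compact_near_coveringP cK.
have /filter_ex[r Kr] : \forall r \near +oo%R, K `<=` dball rho r.
  apply: (cK _ _ (fun r => dball rho r)) => x Kx.
  near=> y r => /=; apply: (@le_trans _ _ (mdist rho x + 1)).
    rewrite (le_trans (metric_triangle _ x _))// lerD2l ltW//.
    by near: y; exact: nbhs_dist.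
  near: r; apply: nbhs_pinfty_ge; exact: num_real.
by exists r.
Unshelve. all: by end_near. Qed.

(** Each point of [K] has a ball missing [A], and half its radius works on a whole neighbourhood of
    the point; compactness of [K] makes the choice uniform. *)
Lemma compact_thickening_disjoint (A K : set M) :
  closed A -> compact K -> A `&` K = set0 ->
  exists2 e, 0 < e & thickening A e `&` K = set0.
Proof.
move=> cA /compact_near_coveringP cK AK.
have H : \forall e \near 0^'+, K `<=` ~` thickening A e.
  apply: (cK _ _ (fun e => ~` thickening A e)) => x Kx.
  have nA : nbhs x (~` A).
    apply: open_nbhs_nbhs; split; first exact: closed_openC.
    by move=> Ax; have : (A `&` K) x by []; rewrite AK.
  have [d /= d0 xd] : exists2 d : R, 0 < d & ball x d `<=` ~` A.
    exact/nbhs_ballP.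
  near=> y e.
  have ed : e < d / 2 by near: e; apply: nbhs_right_lt; exact: divr_gt0.
  move=> [z Az yz]; apply: (xd z) => //; rewrite ballEmdist/=.
  rewrite (le_lt_trans (metric_triangle _ y _))// (splitr d) ltrD//.
    by near: y; apply: nbhs_dist; exact: divr_gt0.
  exact: le_lt_trans yz ed.
have [e [e0 Ke]] : exists e, 0 < e /\ K `<=` ~` thickening A e.
  have /filter_ex[e He] : \forall e \near 0^'+,
      0 < e /\ K `<=` ~` thickening A e.
    by near=> e; split; [near: e; exact: nbhs_right_gt|near: e].
  by exists e.
by exists e => //; apply/seteqP; split=> // x [Ax /Ke].
Unshelve. all: by end_near. Qed.

Lemma fell_cvgP (a : nat -> closedSet M) (A : closedSet M) :
  (a n @[n --> \oo] --> A) <->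
  (forall r e, 0 < e -> \forall n \near \oo, close_upto r e (a n) A).
Proof.
rewrite fell_subbase_cvgP; split => [H r e e0|H W].
  (* The part of the ball outside the open neighbourhood [U] of [A] is compact and misses [A], so
     [a n] eventually misses it too: this is the containment of [a n]. The containment of [A] comes
     from hitting small balls around its points, made uniform by compactness of [A] cut by the
     ball. *)
  pose U := \bigcup_(y in (A : set M)) (ball y e)^°.
  have oU : open U by apply: bigcup_open => y _; exact: open_interior.
  have cK : compact (dball rho r `&` ~` U).
    by apply: compact_closedI; [exact: bcm_compact|exact: open_closedC].
  apply: filterI; last first.
    have /compact_near_coveringP cA : compact (A `&` dball rho r).
      rewrite setIC; apply: compact_closedI; first exact: bcm_compact.
      exact: closed_carP.
    apply: (cA _ \oo (fun n => thickening (a n : set M) e)) => x [Ax _].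
    near=> y n => /=.
    have [z [anz]] : (a n : set M) `&` (ball x (e / 2))^° !=set0.
      near: n; apply: H [set B : closedSet M | B `&` _ !=set0] _ _.
        by right; exists (ball x (e / 2))^° => //; exact: open_interior.
      by exists x; split => //; apply: nbhsx_ballx; rewrite divr_gt0.
    move=> /interior_subset; rewrite ballEmdist/= => xz.
    exists z => //; rewrite (le_trans (metric_triangle _ x _))//.
    rewrite (splitr e) metric_sym lerD// ltW//.
    by near: y; apply: nbhs_dist; rewrite divr_gt0.
  have : \forall n \near \oo, (a n : set M) `&` (dball rho r `&` ~` U) = set0.
    apply: (H [set B : closedSet M | B `&` _ = set0]).
      by left; exists (dball rho r `&` ~` U).
    apply/seteqP; split=> // x [Ax [_ nU]]; apply: nU.
    by exists x => //; exact: nbhsx_ballx.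
  apply: filterS => n an0 x [anx xr].
  have [y Ay /interior_subset] : U x.
    apply: contrapT => nU; suff : (set0 : set M) x by [].
    by rewrite -an0.
  by rewrite ballEmdist/= => yx; exists y => //; rewrite metric_sym ltW.
case=> [[K cK ->]/= AK|[U oU ->]/= [x [Ax Ux]]].
  have [r Kr] := compact_dball_bounded cK.
  have [e e0 eK] := compact_thickening_disjoint (closed_carP (c := A)) cK AK.
  apply: filterS (H r e e0) => n [anA _]; apply/seteqP; split=> // x [anx Kx].
  by rewrite -eK; split=> //; apply: anA; split=> //; exact: Kr.
have [e /= e0 xe] : exists2 e : R, 0 < e & ball x e `<=` U.
  by apply/nbhs_ballP; exact: open_nbhs_nbhs.
have e20 : 0 < e / 2 by rewrite divr_gt0.
apply: filterS (H (mdist rho x) (e / 2) e20) => n [_ Aan].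
have [|y any xy] := Aan x; first by split => //=; rewrite /dball/=.
exists y; split=> //; apply: xe; rewrite ballEmdist/=.
by rewrite (le_lt_trans xy)// ltr_pdivrMr// ltr_pMr// ltr1n.
Unshelve. all: by end_near. Qed.

(* The members of [s] are the distances from the root to the cells of a finite
   cover of [A] by cells of small diameter. *)
Lemma exceptional_radii (A : set M) (T d : R) : 0 < d ->
  exists s : seq R, forall e r, 0 < e -> r + e <= T ->
    (forall m, m \in s -> e *+ 2 < `|r - m|) ->
    A `&` dball rho (r + e) `<=` thickening (A `&` dball rho (r - e)) d.
Proof.
move=> d0; have d20 : 0 < d / 2 by rewrite divr_gt0.
pose pM : ptopologicalType := HB.pack (Metric.sort (M : metricType R)) (isPointed.Build M rho).
have : @cover_compact pM (dball rho T).
  by rewrite -compact_cover; exact: bcm_compact.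
move=> /(_ M setT (fun p => (ball p (d / 2))^°)).
case=> [p _|x _|N _ Ncov]; first exact: open_interior.
  by exists x => //; exact: nbhsx_ballx.
pose E p := [set mdist rho x | x in A `&` ball p (d / 2)].
exists [seq inf (E p) | p <- N] => e r e0 reT good x [Ax xre].
have [p pN /interior_subset px] := Ncov x (le_trans xre reT).
have Ex : E p (mdist rho x) by exists x.
have lbE : has_lbound (E p) by exists 0 => _ [y _ <-]; exact: mdist_ge0.
have infx : inf (E p) <= mdist rho x by exact: ge_inf.
(* The infimum is at most [r + e] and differs from [r] by more than [2 * e], so it lies below
   [r - 2 * e]. The cell of [x] thus contains a point of [A] at distance less than [r - e] from the
   root. *)
have ltr : inf (E p) < r - e *+ 2.
  have /good : inf (E p) \in [seq inf (E p) | p <- N].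
    by apply/mapP; exists p.
  have xr : mdist rho x <= r + e := xre.
  by rewrite lter_normr => /orP[|]; lra.
have [_ [y [Ay py] <-] yinf] := inf_adherent e0 (conj (ex_intro _ _ Ex) lbE).
exists y; first by split=> //; rewrite /dball/=; lra.
move: px py; rewrite !ballEmdist/= => px py.
rewrite (le_trans (metric_triangle _ p _))// (splitr d) lerD// ltW//.
by rewrite metric_sym.
Qed.

Lemma close_upto_fell_dist (A : set M) (c : R) : 0 < c ->
  exists r e, 0 < e /\
    forall B : set M, close_upto r e B A -> (fell_dist B A <= c%:E)%E.
Proof.
move=> c0; have c40 : 0 < c / 4 by rewrite divr_gt0.
(* The list [s] is fixed before [e], so [e] may be chosen according to its size. The extra [c]
   leaves room for [r + e] when [r <= 4 / c] and [e <= c]. *)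
have [s sP] := exceptional_radii A (4 / c + c) c40.
have N0 : 0 < 1 + 4 * (size s)%:R :> R by rewrite ltr_wpDr// mulr_ge0.
(* The bound of [fell_dist_le] with [d = 2 * e] contains [e + 4 * e * size s], which this choice
   makes equal to [c / 2]. The other terms are [c / 4] and [expR (- (4 / c))], itself at most
   [c / 4] because [expR x >= 1 + x]. *)
pose e := c / 2 / (1 + 4 * (size s)%:R).
have e0 : 0 < e by rewrite !divr_gt0.
have ec : e <= c.
  rewrite ler_pdivrMr//; have : 0 <= c * (4 * (size s)%:R) by rewrite !mulr_ge0// ltW.
  by lra.
exists (4 / c), e; split => // B [BA AB].
have T0 : 0 <= 4 / c by rewrite divr_ge0// ltW.
have expT : expR (- (4 / c)) <= c / 4.
  rewrite expRN -[leRHS]invrK lef_pV2 ?posrE ?expR_gt0 ?invr_gt0//.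
  by rewrite invf_div (le_trans _ (expR_ge1Dx _))// lerDr.
apply: le_trans (@fell_dist_le _ M B A (c / 4 + e) (e *+ 2) (4 / c) s _ _ T0 _) _.
- by rewrite addr_ge0// ltW.
- by rewrite mulrn_wge0// ltW.
- move=> r /andP[r0 rT] good.
  (* Points of [A] are first moved inside radius [r - e], so that their [e]-approximants in [B]
     remain within [r]. Conversely a point of [B] within [r] is approximated in [A] within [r + e],
     then pulled inward. *)
  have shrink := sP e r e0 (lerD rT ec) good.
  apply: hausdorff_dist_le; first by rewrite addr_ge0// ltW.
    move=> x [Bx xr]; have [|y Ay xy] := BA x.
      by split=> //; exact: le_trans xr rT.
    have [|z Az yz] := shrink y.
      split=> //; rewrite /dball/= (le_trans (metric_triangle _ x _))// lerD//.
    exists z; last by rewrite addrC (le_trans (metric_triangle _ y _))// lerD.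
    by case: Az => Az zr; split => //; rewrite /dball/= (le_trans zr)// lerBlDr lerDl ltW.
  move=> x [Ax xr]; have [|y [Ay yr] xy] := shrink x.
    by split=> //; rewrite /dball/= (le_trans xr)// lerDl ltW.
  have [|z Bz yz] := AB y.
    by split=> //; rewrite /dball/= (le_trans yr)// (le_trans _ rT)// lerBlDr lerDl ltW.
  exists z; last by rewrite (le_trans (metric_triangle _ y _))// lerD.
  split=> //; rewrite /dball/= (le_trans (metric_triangle _ y _))//.
  have yre : mdist rho y <= r - e := yr.
  by lra.
rewrite lee_fin.
have eE : e * (1 + 4 * (size s)%:R) = c / 2 by rewrite mulfVK// gt_eqF.
have -> : e *+ 2 *+ 2 *+ size s = e * (4 * (size s)%:R).
  by rewrite -[LHS]mulr_natr !mulr2n; ring.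
by move: eE expT; rewrite mulrDr mulr1; lra.
Qed.

End fell_metric.

(** * Metric quotients and gluing *)

Record pseudodist (R : realType) (S : Type) := Pseudodist {
  pdist :> S -> S -> R;
  pdistxx : forall s, pdist s s = 0;
  pdistC : forall s t, pdist s t = pdist t s;
  pdist_triangle : forall s t u, pdist s u <= pdist s t + pdist t u }.

Section metric_quotient.
Variables (R : realType) (S : Type) (D : pseudodist R S).

(* A class of points at distance 0 is represented by the distance function of
   any of its members. *)
Definition mquot := {f : S -> R | exists s, D s = f}.

HB.instance Definition _ := gen_eqMixin mquot.
HB.instance Definition _ := gen_choiceMixin mquot.

Definition mquot_repr (p : mquot) : S := sval (cid (svalP p)).

Lemma mquot_reprE p : D (mquot_repr p) = sval p.
Proof. by rewrite /mquot_repr; case: cid. Qed.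

Definition mproj (s : S) : mquot := exist _ (D s) (ex_intro _ s erefl).

Definition mquot_dist (p q : mquot) : R := D (mquot_repr p) (mquot_repr q).

Lemma mquot_distxx p : mquot_dist p p = 0.
Proof. exact: pdistxx. Qed.

Lemma mquot_inj (p q : mquot) : sval p = sval q -> p = q.
Proof.
case: p q => [f fP] [g gP] /= fg; subst g.
by rewrite (Prop_irrelevance fP gP).
Qed.

Lemma mquot_dist_eq0 p q : mquot_dist p q = 0 -> p = q.
Proof.
move=> pq; apply: mquot_inj.
move: pq; rewrite /mquot_dist -!mquot_reprE.
move: (mquot_repr _) (mquot_repr _) => t s st; apply/funext => u; apply/eqP; rewrite eq_le; apply/andP; split.
  by have := pdist_triangle D s t u; rewrite st add0r.
by have := pdist_triangle D t s u; rewrite (pdistC D t s) st add0r.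
Qed.

Lemma mquot_distC p q : mquot_dist p q = mquot_dist q p.
Proof. exact: pdistC. Qed.

Lemma mquot_dist_triangle q p r :
  mquot_dist p r <= mquot_dist p q + mquot_dist q r.
Proof. exact: pdist_triangle. Qed.

HB.instance Definition _ := @isMetric.Build R mquot mquot_dist
  mquot_distxx mquot_dist_eq0 mquot_distC mquot_dist_triangle.

Lemma mproj_dist s t : mdist (mproj s) (mproj t) = D s t.
Proof.
have -> : mdist (mproj s) (mproj t) = mquot_dist (mproj s) (mproj t) by [].
by rewrite /mquot_dist mquot_reprE /= pdistC mquot_reprE /= pdistC.
Qed.

Lemma mproj_surj p : exists s, mproj s = p.
Proof.
by exists (mquot_repr p); apply: mquot_inj; exact: mquot_reprE.
Qed.

Lemma mproj_eq s t : D s t = 0 -> mproj s = mproj t.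
Proof. by move=> st; apply: mdist_positivity; rewrite mproj_dist. Qed.

(** Universal property of the quotient: a map realizing [D] as a distance identifies points at
    distance 0, hence factors through an isometric embedding. *)
Lemma mquot_lift (Z : metricType R) (m : S -> Z) :
  (forall s t, mdist (m s) (m t) = D s t) ->
  exists2 h : mquot -> Z,
    forall p q, mdist (h p) (h q) = mdist p q & forall s, h (mproj s) = m s.
Proof.
move=> mD; exists (fun p => m (mquot_repr p)) => [p q|s]; first exact: mD.
by apply: mdist_positivity; rewrite mD mquot_reprE; exact: pdistxx.
Qed.

End metric_quotient.

(** * Bounded compactness of unions of embedded spaces *)

Lemma compact_isometric_image (R : realType) (S T : metricType R) (f : S -> T)
    (A : set S) :
  (forall x y, mdist (f x) (f y) = mdist x y) -> compact A -> compact (f @` A).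
Proof.
move=> fiso cA; apply: continuous_compact => //; apply: continuous_subspaceT.
move=> x; apply/metricType_numDomainType.cvgrPdist_lt => e e0.
rewrite near_simpl; have := nbhsx_ballx x e e0; apply: filterS => y.
by rewrite ballEmdist/= fiso.
Qed.

Lemma metric_nbhsP (R : realType) (M : metricType R) (x : M) (U : set M) :
  nbhs x U <-> exists2 e : R, 0 < e & forall y, mdist x y < e -> U y.
Proof.
split=> [/nbhs_ballP[e e0 eU]|[e e0 eU]]; first exists e => // y xy.
  by apply: eU; rewrite ballEmdist.
by apply/nbhs_ballP; exists e => // y; rewrite ballEmdist; exact: eU.
Qed.

(* An ultrafilter on a ball either contains one of the [P i], or all the
   thickenings of [K]; in the latter case it clusters at a point of [K]. *)
Lemma compact_dball_of_approximation (R : realType) (M : metricType R) (p : M)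
    (K : set M) (P : nat -> set M) :
  (forall r : R, compact (K `&` dball p r)) ->
  (forall i (r : R), compact (P i `&` dball p r)) ->
  [set: M] `<=` K `|` \bigcup_i P i ->
  (forall r e : R, 0 < e -> \forall i \near \oo, P i `&` dball p r `<=` thickening K e) ->
  forall (x : M) (r : R), compact (dball x r).
Proof.
move=> cK cP cov close x0 r0.
have clD (x : M) (r : R) : closed (@dball R M x r).
  rewrite -[X in closed X]setCK; apply: open_closedC; rewrite openE => y /= /negP.
  rewrite -ltNge => ry; apply/metric_nbhsP; exists (mdist x y - r).
    by rewrite subr_gt0.
  move=> z yz xz; have xz' : mdist x z <= r := xz.
  by have := metric_triangle x z y; rewrite (metric_sym z y); lra.
suff H (r : R) : compact (dball p r).
  apply: (@subclosed_compact _ _ (dball p (mdist p x0 + r0))) => //.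
  move=> y xy; rewrite /dball/= (le_trans (metric_triangle _ x0 _))//.
  by rewrite lerD2l.
rewrite compact_ultra => F UF FD.
have [[i FPi]|nP] := pselect (exists i, F (P i)).
  have := cP i r; rewrite compact_ultra => /(_ _ UF (filterI FPi FD)).
  by move=> [y [[_ Dy] Fy]]; exists y.
have Fthick e : 0 < e -> F (thickening K e).
  move=> e0; have [n _ nclose] := close r e e0.
  (* The ultrafilter contains the complement of each [P i], hence of the finitely many with index
     below [n]; the remaining ones are [e]-close to [K] within the ball. *)
  have FC : F [set y | forall i : 'I_n, ~ P i y].
    apply: filter_forall => i; have [FPi|//] := in_ultra_setVsetC (P i) UF.
    by absurd: nP; exists i.
  apply: filterS (filterI FD FC) => y [Dy nPy].
  have [|Ky|[i _ Piy]] := cov y; first by [].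
    by exists y => //; rewrite mdistxx ltW.
  apply: (nclose i); last by split.
  by rewrite /= leqNgt; apply/negP => lin; exact: (nPy (Ordinal lin)).
(* [G] is generated by the traces on [K] of thickenings of members of [F]. A cluster point of [G] is
   also one of [F], and an ultrafilter converges to its cluster points. *)
pose G := filter_from [set eE : R * set M | 0 < eE.1 /\ F eE.2]
  (fun eE => K `&` thickening eE.2 eE.1).
have PG : ProperFilter G.
  apply: filter_from_proper; last first.
    move=> [e E] [/= e0 FE]; have [y [Ey [z Kz yz]]] := filter_ex (filterI FE (Fthick e e0)).
    by exists z; split => //; exists y => //; rewrite metric_sym.
  apply: filter_from_filter; first by exists (1, setT); split => //; exact: filterT.
  move=> [e E] [e' E'] [/= e0 FE] [/= e'0 FE'].
  exists (Order.min e e', E `&` E') => /=; first by split; [rewrite lt_min e0|exact: filterI].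
  by move=> y [Ky [z [Ez E'z]]]; rewrite le_min => /andP[yz yz']; split; split => //; exists z.
(* Points of [K] within 1 of [dball p r] lie in [dball p (r + 1)]. *)
have [|y [[Ky _] Gy]] := cK (r + 1) G PG.
  exists (1, dball p r) => //= z [Kz [w pw zw]]; split => //.
  by rewrite /dball/= (le_trans (metric_triangle _ w _))// lerD// metric_sym.
have Fy : cluster F y.
  move=> E U FE /metric_nbhsP[e e0 yU].
  have e20 : 0 < e / 2 by rewrite divr_gt0.
  have [|z [[_ [w Ew zw]] yz]] := Gy (K `&` thickening E (e / 2)) (ball y (e / 2)) _ (nbhsx_ballx _ _ e20).
    by exists (e / 2, E).
  exists w; split=> //; apply: yU; move: yz; rewrite ballEmdist/= => yz.
  by rewrite (le_lt_trans (metric_triangle _ z _))// (splitr e) ltr_leD.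
exists y; split; last by move: Fy; rewrite ultra_cvg_clusterE.
by apply: (clD p r y) => U Uy; have [w [Dw Uw]] := Fy _ _ FD Uy; exists w.
Qed.

Section quotient_of_bcm.
Variables (R : realType).

Lemma compact_range_dball (X : rootedBcm R) (Q : metricType R) (j : X -> Q)
    (r : R) : (forall x y, mdist (j x) (j y) = mdist x y) ->
  compact (range j `&` dball (j (broot X)) r).
Proof.
move=> jiso; have -> : range j `&` dball (j (broot X)) r = j @` dball (broot X) r.
  apply/seteqP; split=> [_ [[x _ <-]]|_ [x xr <-]].
    by rewrite /dball/= jiso => xr; exists x.
  by split; [exists x|rewrite /dball/= jiso].
by apply: compact_isometric_image => //; exact: bcm_compact.
Qed.

(* Both sides are the mark distance in the metric quotient of [X + Y], which
   embeds in [Z] and in [W]. *)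
Lemma coupling_srm (tau : structure R) (srm : space_rooted_metrization tau)
    (X Y Z W : rootedBcm R) (f : rooted_isoemb X Z) (g : rooted_isoemb Y Z)
    (f' : rooted_isoemb X W) (g' : rooted_isoemb Y W) (a : tau X) (b : tau Y) :
  (forall x y, mdist (f x) (g y) = mdist (f' x) (g' y)) ->
  srm_metric srm Z (tau_map tau f a) (tau_map tau g b) =
  srm_metric srm W (tau_map tau f' a) (tau_map tau g' b).
Proof.
move=> fg; pose m (s : X + Y) : Z := match s with inl x => f x | inr y => g y end.
pose D : pseudodist R (X + Y) := @Pseudodist R _ (fun s t => mdist (m s) (m t))
  (fun s => mdistxx (m s)) (fun s t => metric_sym (m s) (m t))
  (fun s t u => metric_triangle (m s) (m t) (m u)).
pose jX (x : X) := mproj D (inl x); pose jY (y : Y) := mproj D (inr y).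
have jXP x x' : mdist (jX x) (jX x') = mdist x x'.
  by rewrite mproj_dist /= isoembP.
have jYP y y' : mdist (jY y) (jY y') = mdist y y'.
  by rewrite mproj_dist /= isoembP.
have jroot : jY (broot Y) = jX (broot X).
  by apply: mproj_eq; rewrite /= !isoemb_root mdistxx.
have Qc : forall (x : mquot D) (r : R), compact (dball x r).
  (* The piece of index 0 is the image of [Y]; the later ones repeat the image of [X], for which the
     approximation condition is trivial. *)
  apply: (@compact_dball_of_approximation R _ (jX (broot X)) (range jX)
    (fun i => if i is 0%N then range jY else range jX)).
  - by move=> r; exact: compact_range_dball.
  - by case=> [|i] r; [rewrite -jroot|]; exact: compact_range_dball.
  - move=> q _; have [[x|y] <-] := mproj_surj q; first by left; exists x.
    by right; exists 0%N => //; exists y.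
  - move=> r e e0; exists 1%N => // -[//|i] _ x [Xx _].
    by exists x => //; rewrite mdistxx ltW.
have Q0 : [set: mquot D] !=set0 by exists (jX (broot X)).
pose Q := @RootedBcm R (BcmSpace Q0 Qc) (jX (broot X)).
pose JX : rooted_isoemb X Q := @RootedIsoEmb R X Q (@IsoEmb R X Q jX jXP) erefl.
pose JY : rooted_isoemb Y Q := @RootedIsoEmb R Y Q (@IsoEmb R Y Q jY jYP) jroot.
suff lift (V : rootedBcm R) (h : rooted_isoemb X V) (k : rooted_isoemb Y V) :
    (forall x y, mdist (f x) (g y) = mdist (h x) (k y)) ->
    srm_metric srm V (tau_map tau h a) (tau_map tau k b) =
    srm_metric srm Q (tau_map tau JX a) (tau_map tau JY b).
  by rewrite (lift Z f g)// (lift W f' g').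
move=> fghk; pose n (s : X + Y) : V := match s with inl x => h x | inr y => k y end.
have [|i iP iproj] := @mquot_lift _ _ D V n.
  by case=> [x|y] [x'|y']; rewrite /= ?isoembP// metric_sym -fghk metric_sym.
have iroot : @IsoEmb R Q V i iP (broot Q) = broot V.
  exact: etrans (iproj (inl (broot X))) (isoemb_root h).
pose I : rooted_isoemb Q V := RootedIsoEmb iroot.
rewrite -(srm_isometric srm I) -!tau_comp.
by congr (srm_metric srm V (tau_map tau _ a) (tau_map tau _ b));
  apply: isoemb_ext => x; rewrite /= iproj.
Qed.

End quotient_of_bcm.

(* [c] is the cross part of a pseudometric on the disjoint union of [X] and [Y]
   that extends the two metrics. *)
Record is_coupling (R : realType) (X Y : metricType R) (c : X -> Y -> R) : Prop :=
  IsCoupling {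
    coupling_lel : forall x x' y, c x y <= mdist x x' + c x' y;
    coupling_ler : forall x y y', c x y <= c x y' + mdist y' y;
    coupling_gel : forall x x' y, mdist x x' <= c x y + c x' y;
    coupling_ger : forall x y y', mdist y y' <= c x y + c x y' }.

Lemma isoemb_coupling (R : realType) (X Y Z : bcmSpace R) (f : isoemb X Z)
  (g : isoemb Y Z) : is_coupling (fun x y => mdist (f x) (g y)).
Proof.
split=> [x x' y|x y y'|x x' y|x y y'].
- by rewrite -(isoembP f) metric_triangle.
- by rewrite -(isoembP g) metric_triangle.
- by rewrite -(isoembP f) (metric_sym (f x')) metric_triangle.
- by rewrite -(isoembP g) (metric_sym (f x)) metric_triangle.
Qed.

(** These are the cross distances when [X] and [Y] are joined at their roots; they provide a
    coupling for any pair of spaces. *)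
Lemma wedge_coupling (R : realType) (X Y : rootedBcm R) :
  is_coupling (fun (x : X) (y : Y) => mdist x (broot X) + mdist (broot Y) y).
Proof.
split=> [x x' y|x y y'|x x' y|x y y'].
- by rewrite addrA lerD2r metric_triangle.
- by rewrite -addrA lerD2l metric_triangle.
- have := metric_triangle x (broot X) x'; rewrite (metric_sym (broot X) x').
  by have := mdist_ge0 (broot Y) y; lra.
- have := metric_triangle y (broot Y) y'; rewrite (metric_sym y (broot Y)).
  by have := mdist_ge0 x (broot X); lra.
Qed.

(** * Gluing a sequence of spaces to a common base *)

Section glue.
Variables (R : realType) (X : nat -> metricType R) (Y : metricType R) (y0 : Y).
Variables (c : forall n, X n -> Y -> R) (cP : forall n, is_coupling (@c n)).

Local Notation S := ({n & X n} + Y)%type.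

Definition dist_to_base (s : S) (y : Y) : R :=
  match s with inl p => c (tagged p) y | inr y' => mdist y' y end.

Local Notation u := dist_to_base.

Lemma dist_to_base_lip s y y' : u s y <= u s y' + mdist y' y.
Proof.
case: s => [[n x]|z] /=; first exact: (coupling_ler (cP n)).
exact: metric_triangle.
Qed.

Lemma dist_to_base_ge s y y' : mdist y y' <= u s y + u s y'.
Proof.
case: s => [[n x]|z] /=; first exact: (coupling_ger (cP n)).
by rewrite (metric_sym z y) metric_triangle.
Qed.

Inductive route : S -> S -> R -> Prop :=
| route_via s t z : route s t (u s z + u t z)
| route_same n x x' :
    route (inl (Tagged X (x : X n))) (inl (Tagged X (x' : X n))) (mdist x x').

Lemma route_sym s t v : route s t v -> route t s v.
Proof.
by case=> [{}s {}t z|n x x']; [rewrite addrC|rewrite metric_sym]; constructor.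
Qed.

Lemma route_base s t v y : route s t v -> u s y <= v + u t y.
Proof.
case=> [{}s {}t z|n x x']; last exact: (coupling_lel (cP n)).
rewrite (le_trans (dist_to_base_lip s y z))// -addrA lerD2l.
exact: dist_to_base_ge.
Qed.

Lemma routeP s t v : route s t v ->
  (exists z, v = u s z + u t z) \/
  (exists n (x x' : X n), [/\ s = inl (Tagged X x), t = inl (Tagged X x') &
     v = mdist x x']).
Proof. by case=> [{}s {}t z|n x x']; [left; exists z|right; exists n, x, x']. Qed.

Lemma inl_Tagged_inj n (x x' : X n) :
  inl (Tagged X x) = inl (Tagged X x') :> S -> x = x'.
Proof. by move=> -[] /eqP; rewrite eq_Tagged => /eqP. Qed.

(** If one route passes through a point [z] of the base, [route_base] absorbs the other into a
    direct way to [z]. Otherwise both stay in one [X n], the same for both because they share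
    [t]. *)
Lemma route_triangle s t r v w : route s t v -> route t r w ->
  exists2 x, route s r x & x <= v + w.
Proof.
move=> stv trw; case: (routeP stv) => [[z vE]|[n [x [x' [sE tE vE]]]]].
  exists (u s z + u r z); first exact: route_via.
  by have := route_base z (route_sym trw); rewrite vE; lra.
case: (routeP trw) => [[z wE]|[m [y [y' [tE' rE wE]]]]].
  exists (u s z + u r z); first exact: route_via.
  by have := route_base z stv; rewrite wE; lra.
have nm : n = m by move: tE'; rewrite tE => -[].
subst m; exists (mdist x y'); first by rewrite sE rE; exact: route_same.
rewrite vE wE; have -> : y = x' by apply: inl_Tagged_inj; rewrite -tE -tE'.
exact: metric_triangle.
Qed.

Definition glue_dist (s t : S) : R := inf (route s t).

Lemma route_ge0 s t v : route s t v -> 0 <= v.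
Proof.
case=> [{}s {}t z|n x x']; last exact: mdist_ge0.
have := dist_to_base_ge s z z; have := dist_to_base_ge t z z.
by rewrite mdistxx; lra.
Qed.

Lemma glue_dist_le s t v : route s t v -> glue_dist s t <= v.
Proof. by apply: ge_inf; exists 0 => w; exact: route_ge0. Qed.

Lemma glue_dist_ge s t x : (forall v, route s t v -> x <= v) -> x <= glue_dist s t.
Proof.
(* The point [y0] ensures that some route exists, so the infimum is over a nonempty set. *)
by move=> xle; apply: lb_le_inf => //; exists (u s y0 + u t y0); exact: route_via.
Qed.

(** A detour through the base is no shortcut, by [coupling_gel]; each embedding into the glued space
    is therefore isometric. *)
Lemma glue_dist_tagged n (x x' : X n) :
  glue_dist (inl (Tagged X x)) (inl (Tagged X x')) = mdist x x'.
Proof.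
apply/eqP; rewrite eq_le glue_dist_le ?andTb; last exact: route_same.
apply: glue_dist_ge => v /routeP[[z ->]|[m [y [y' [E E' ->]]]]].
  exact: (coupling_gel (cP n)).
have nm : n = m by case: E.
by subst m; rewrite (inl_Tagged_inj E) (inl_Tagged_inj E').
Qed.

Lemma glue_dist_base y y' : glue_dist (inr y) (inr y') = mdist y y'.
Proof.
apply/eqP; rewrite eq_le; apply/andP; split.
  by have := glue_dist_le (route_via (inr y) (inr y') y'); rewrite /= mdistxx addr0.
apply: glue_dist_ge => v /routeP[[z ->]|[m [? [? [//]]]]] /=.
by rewrite (metric_sym y') metric_triangle.
Qed.

Lemma glue_dist_tagged_base n (x : X n) y :
  glue_dist (inl (Tagged X x)) (inr y) = c x y.
Proof.
apply/eqP; rewrite eq_le; apply/andP; split.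
  have := glue_dist_le (route_via (inl (Tagged X x)) (inr y) y).
  by rewrite /= mdistxx addr0.
apply: glue_dist_ge => v /routeP[[z ->]|[m [? [? [_ //]]]]] /=.
by rewrite (metric_sym y); exact: (coupling_ler (cP n)).
Qed.

Lemma glue_distxx s : glue_dist s s = 0.
Proof. by case: s => [[n x]|y]; rewrite ?glue_dist_tagged ?glue_dist_base mdistxx. Qed.

Lemma glue_distC s t : glue_dist s t = glue_dist t s.
Proof.
by apply/eqP; rewrite eq_le !glue_dist_ge// => v /route_sym/glue_dist_le.
Qed.

Lemma glue_dist_triangle s t r : glue_dist s r <= glue_dist s t + glue_dist t r.
Proof.
rewrite -lerBlDr; apply: glue_dist_ge => v stv.
rewrite lerBlDr -lerBlDl; apply: glue_dist_ge => w trw; rewrite lerBlDl.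
by have [x /glue_dist_le] := route_triangle stv trw; exact: le_trans.
Qed.

Definition glue_pseudodist : pseudodist R S :=
  Pseudodist glue_distxx glue_distC glue_dist_triangle.

End glue.

Definition coupling_close (R : realType) (X Y : rootedBcm R) (c : X -> Y -> R)
    (r e : R) :=
  (forall x, mdist (broot X) x <= r -> exists y, c x y <= e) /\
  (forall y, mdist (broot Y) y <= r -> exists x, c x y <= e).

(** Closeness of the images is a property of the coupling alone, so it transfers between any two
    ambient spaces with the same cross distances. *)
Lemma close_upto_range (R : realType) (X Y Z : rootedBcm R)
    (f : rooted_isoemb X Z) (g : rooted_isoemb Y Z) (r e : R) :
  close_upto r e (range f : set Z) (range g : set Z) <->
  coupling_close (fun x y => mdist (f x) (g y)) r e.
Proof.
split=> [[fg gf]|[fg gf]]; split.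
- move=> x xr; have [|_ [y _ <-] xy] := fg (f x); last by exists y.
  by split; [exists x|rewrite /dball/= -(isoemb_root f) isoembP].
- move=> y yr; have [|_ [x _ <-] xy] := gf (g y); last by exists x; rewrite metric_sym.
  by split; [exists y|rewrite /dball/= -(isoemb_root g) isoembP].
- move=> _ [[x _ <-]]; rewrite /dball/= -(isoemb_root f) isoembP => /fg[y xy].
  by exists (g y) => //; exists y.
- move=> _ [[y _ <-]]; rewrite /dball/= -(isoemb_root g) isoembP => /gf[x xy].
  by exists (f x); [exists x|rewrite metric_sym].
Qed.

(** The zero coupling of roots merges all roots into one point of the quotient, and eventual
    closeness supplies the approximation by [Y] that makes its balls compact. *)
Lemma exists_glue_space (R : realType) (X : nat -> rootedBcm R) (Y : rootedBcm R)
    (c : forall n, X n -> Y -> R) :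
  (forall n, is_coupling (@c n)) -> (forall n, c n (broot (X n)) (broot Y) = 0) ->
  (forall r e : R, 0 < e -> \forall n \near \oo, coupling_close (@c n) r e) ->
  exists (M : rootedBcm R) (f : forall n, rooted_isoemb (X n) M)
    (g : rooted_isoemb Y M), forall n x y, mdist (f n x) (g y) = c n x y.
Proof.
move=> cP c0 cclose.
pose D := @glue_pseudodist R X Y (broot Y) c cP.
pose j n (x : X n) := mproj D (inl (Tagged (fun n => X n : Type) x)).
pose k (y : Y) := mproj D (inr y).
have jP n x x' : mdist (@j n x) (@j n x') = mdist x x'.
  by rewrite mproj_dist; exact: (@glue_dist_tagged R X Y (broot Y) c cP).
have kP y y' : mdist (k y) (k y') = mdist y y'.
  by rewrite mproj_dist; exact: (@glue_dist_base R X Y (broot Y) c).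
have jkP n x y : mdist (@j n x) (k y) = c n x y.
  by rewrite mproj_dist; exact: (@glue_dist_tagged_base R X Y (broot Y) c cP).
have jroot n : j n (broot (X n)) = k (broot Y).
  by apply: mdist_positivity; rewrite jkP.
have Mc : forall (x : mquot D) (r : R), compact (dball x r).
  apply: (@compact_dball_of_approximation R _ (k (broot Y)) (range k)
    (fun n => range (@j n))).
  - by move=> r; exact: compact_range_dball.
  - by move=> n r; rewrite -(jroot n); exact: compact_range_dball.
  - move=> q _; have [[[n x]|y] <-] := mproj_surj q; last by left; exists y.
    by right; exists n => //; exists x.
  - move=> r e e0; apply: filterS (cclose r e e0) => n [close _] _ [[x _ <-]].
    rewrite /dball/= -(jroot n) jP => /close[y xy].
    by exists (k y); [exists y|rewrite jkP].
have M0 : [set: mquot D] !=set0 by exists (k (broot Y)).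
pose M := @RootedBcm R (BcmSpace M0 Mc) (k (broot Y)).
exists M, (fun n => @RootedIsoEmb R (X n) M (@IsoEmb R (X n) M (@j n) (@jP n)) (jroot n)).
by exists (@RootedIsoEmb R Y M (@IsoEmb R Y M k kP) erefl).
Qed.

(** * Convergence of marked spaces *)

Lemma metrizes_cvgP (R : realType) (T : topologicalType) (d : T -> T -> R)
    (a : nat -> T) (l : T) : metrizes d ->
  (a n @[n --> \oo] --> l) <->
  (forall e, 0 < e -> \forall n \near \oo, d l (a n) < e).
Proof.
move=> dP; split=> [al e e0|H W].
  by apply: (al [set y | d l y < e]); rewrite (metrizes_nbhs dP); exists e.
by rewrite (metrizes_nbhs dP) => -[e e0 eW]; apply: filterS (H e e0) => n; exact: eW.
Qed.

Lemma cvge0P (R : realType) (v : nat -> \bar R) : (forall n, 0 <= v n)%E ->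
  (v n @[n --> \oo] --> 0%E) <->
  (forall e : R, 0 < e -> \forall n \near \oo, (v n < e%:E)%E).
Proof.
move=> v0; split=> [/fine_cvgP[vfin /cvgrPdist_lt H] e e0|H].
  apply: filterS2 vfin (H e e0) => n vn; rewrite sub0r normrN => vne.
  by rewrite -(fineK vn) lte_fin (le_lt_trans (ler_norm _)).
apply/fine_cvgP; split.
  by apply: filterS (H 1 ltr01) => n vn; rewrite ge0_fin_numE// (lt_trans vn)// ltry.
apply/cvgrPdist_lt => e e0; apply: filterS (H e e0) => n vn.
rewrite sub0r normrN ger0_norm ?fine_ge0// -lte_fin fineK//.
by rewrite ge0_fin_numE// (lt_trans vn)// ltry.
Qed.

Section srm_dist_convergence.
Variables (R : realType) (tau : structure R) (srm : space_rooted_metrization tau).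

Lemma srm_dist_ge0 (X Y : marked tau) : (0 <= srm_dist srm X Y)%E.
Proof.
apply: le_ereal_inf_tmp => _ [Z [f [g ->]]].
by rewrite le_max fell_dist_ge0.
Qed.

(** Gluing requires a coupling for every [n], whereas approximation is asked only at finite
    distance, which convergence ensures eventually. The slack [1 / (n + 1)] vanishes in the
    limit. *)
Definition near_optimal (X Y : marked tau) (n : nat) (c : X -> Y -> R) : Prop :=
  [/\ is_coupling c, c (broot X) (broot Y) = 0 &
    (srm_dist srm X Y < +oo)%E ->
    exists (Z : rootedBcm R) (f : rooted_isoemb X Z) (g : rooted_isoemb Y Z),
      [/\ c = fun x y => mdist (f x) (g y),
          (fell_dist (range f : set Z) (range g : set Z) <
             srm_dist srm X Y + (n.+1%:R^-1)%:E)%E &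
          ((srm_metric srm Z (tau_map tau f (mark X))
                             (tau_map tau g (mark Y)))%:E <
             srm_dist srm X Y + (n.+1%:R^-1)%:E)%E]].

Lemma exists_near_optimal (X Y : marked tau) n :
  exists c : X -> Y -> R, near_optimal n c.
Proof.
have [XYfin|XYoo] := pselect (srm_dist srm X Y < +oo)%E; last first.
  exists (fun x y => mdist x (broot X) + mdist (broot Y) y); split=> //.
    exact: wedge_coupling.
  by rewrite !mdistxx addr0.
have : (srm_dist srm X Y < srm_dist srm X Y + (n.+1%:R^-1)%:E)%E.
  by rewrite lteDl ?lte_fin ?invr_gt0// ge0_fin_numE// srm_dist_ge0.
move=> /ereal_inf_lt[_ [Z [f [g ->]]]]; rewrite gt_max => /andP[fell srmlt].
exists (fun x y => mdist (f x) (g y)); split; first exact: isoemb_coupling.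
  by rewrite !isoemb_root mdistxx.
by move=> _; exists Z, f, g.
Qed.

End srm_dist_convergence.

Theorem theorem6p18 (R : realType) (tau : structure R)
    (srm : space_rooted_metrization tau)
    (X : nat -> marked tau) (Xoo : marked tau) :
  (srm_dist srm (X n) Xoo @[n --> \oo] --> 0%E) <->
  (exists (M : rootedBcm R) (f : forall n : nat, rooted_isoemb (X n) M)
          (foo : rooted_isoemb Xoo M),
     (isoemb_image (f n) @[n --> \oo] --> isoemb_image foo) /\
     (tau_map tau (f n) (mark (X n)) @[n --> \oo] -->
        tau_map tau foo (mark Xoo))).
Proof.
rewrite (cvge0P (fun n => srm_dist_ge0 srm (X n) Xoo)); split; last first.
  move=> [M [f [foo [/fell_cvgP fellM /(metrizes_cvgP _ _ (srm_metrizes srm M)) tauM]]]].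
  move=> e e0; have e20 : 0 < e / 2 by rewrite divr_gt0.
  (* The bound obtained is non-strict; using [e / 2] makes it strictly below [e]. *)
  have [r [d [d0 fell]]] := close_upto_fell_dist (range foo) e20.
  apply: filterS2 (fellM r d d0) (tauM e e0) => n /fell fn taun.
  apply: (@le_lt_trans _ _ (maxe (fell_dist (range (f n) : set M) (range foo : set M))
      (srm_metric srm M (tau_map tau (f n) (mark (X n)))
         (tau_map tau foo (mark Xoo)))%:E)).
    by apply: ereal_inf_lbound; exists M, (f n), foo.
  rewrite gt_max (le_lt_trans fn) ?lte_fin ?ltr_pdivrMr ?ltr_pMr ?ltr1n//=.
  by rewrite (metrizes_sym (srm_metrizes srm M)).
move=> srm0.
pose c n := sval (cid (exists_near_optimal srm (X n) Xoo n)).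
have cP n : near_optimal srm n (c n) := svalP (cid (exists_near_optimal srm (X n) Xoo n)).
have close e : 0 < e -> \forall n \near \oo,
    exists (Z : rootedBcm R) (f : rooted_isoemb (X n) Z) (g : rooted_isoemb Xoo Z),
    [/\ c n = fun x y => mdist (f x) (g y),
        (fell_dist (range f : set Z) (range g : set Z) < e%:E)%E &
        srm_metric srm Z (tau_map tau f (mark (X n)))
                         (tau_map tau g (mark Xoo)) < e].
  move=> e0; have e20 : 0 < e / 2 by rewrite divr_gt0.
  apply: filterS2 (srm0 _ e20) (near_infty_natSinv_lt (PosNum e20)) => n sn /= ne.
  have [_ _ []] := cP n; first by rewrite (lt_trans sn)// ltry.
  have se : (srm_dist srm (X n) Xoo + (n.+1%:R^-1)%:E < e%:E)%E.
    by rewrite [in ltRHS](splitr e) EFinD lteD// lte_fin.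
  move=> Z [f [g [cE /lt_trans fell /lt_trans srmlt]]]; exists Z, f, g; split=> //.
    exact: fell.
  by rewrite -lte_fin; exact: srmlt.
have cclose r e : 0 < e -> \forall n \near \oo, coupling_close (c n) r e.
  (* [Num.min e 1] and [Num.max r 0] bring error and radius into the range of [fell_dist_lt_close];
     closeness for them implies closeness for [e] and [r]. *)
  move=> e0; pose e' := Num.min e 1; have e'0 : 0 < e' by rewrite lt_min e0/=.
  have := close (expR (- (Num.max r 0 + 1)) * e').
  rewrite mulr_gt0 ?expR_gt0// => /(_ isT); apply: filterS.
  move=> n [Z [f [g [-> fell _]]]].
  have [||fg gf] := fell_dist_lt_close _ _ fell.
  - by rewrite le_max lexx orbT.
  - by rewrite e'0 /= ge_min lexx orbT.
  suff [xy yx] : coupling_close (fun x y => mdist (f x) (g y)) (Num.max r 0) e'.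
    split=> [x xr|y yr]; [have [|y] := xy x|have [|x] := yx y].
    + by rewrite le_max xr.
    + by rewrite le_min => /andP[? _]; exists y.
    + by rewrite le_max yr.
    + by rewrite le_min => /andP[? _]; exists x.
  by apply/close_upto_range; split.
have [||M [f [foo ffoo]]] := exists_glue_space _ _ cclose.
- by move=> n; case: (cP n).
- by move=> n; case: (cP n).
exists M, f, foo; split.
  apply/fell_cvgP => r e e0; apply: filterS (cclose r e e0) => n cn.
  apply/close_upto_range.
  by have -> : (fun x y => mdist (f n x) (foo y)) = c n by
    apply/funext => x; apply/funext => y; exact: ffoo.
apply/(metrizes_cvgP _ _ (srm_metrizes srm M)) => e e0.
apply: filterS (close e e0) => n [Z [g [h [cE _]]]].
(* The mark distance in [M] equals the one in the near-optimal space [Z], since both pairs of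
   embeddings have [c n] as cross distances. *)
rewrite (metrizes_sym (srm_metrizes srm M)) (@coupling_srm R tau srm _ _ M Z (f n) foo g h)//.
by move=> x y; rewrite ffoo cE.
Qed.
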